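(* Let $\mathrm{X}_1\subset\mathbb{R}^{n_1}$ and $\mathrm{X}_2\subset\mathbb{R}^{n_2}$ be nonempty, convex, and compact. Let $J_1:\mathrm{X}_1\times\mathrm{X}_2\to\mathbb{R}$ be continuous on $\mathrm{X}_1\times\mathrm{X}_2$, and let $\mathrm{BR}_2$ be the best-response correspondence of Player 2. Suppose that: (i) there is $\mu>0$ such that for every fixed $x_2\in\mathrm{X}_2$ the function $J_1(\cdot,x_2)$ is differentiable and $\mu$-strongly convex on $\mathrm{X}_1$; (ii) there is $L_{12}\ge 0$ such that for every $x_1\in\mathrm{X}_1$ and all $x_2,y_2\in\mathrm{X}_2$, $\|\nabla_{x_1}J_1(x_1,x_2)-\nabla_{x_1}J_1(x_1,y_2)\|\le L_{12}\|x_2-y_2\|$; (iii) for every $x_1\in\mathrm{X}_1$, $\mathrm{BR}_2(x_1)$ is single-valued (a singleton), so that $\mathrm{BR}_2$ is regarded as a map $\mathrm{X}_1\to\mathrm{X}_2$; (iv) the map $\mathrm{BR}_2:\mathrm{X}_1\to\mathrm{X}_2$ is Lipschitz on $\mathrm{X}_1$ with constant $L_2\ge 0$. If $\mu>L_{12}L_2$, then the Nash equilibrium of the asymmetric-information two-player game defined by $(\mathrm{X}_1,\mathrm{X}_2,J_1,\mathrm{BR}_2)$ is unique, i.e. the game has exactly one Nash equilibrium.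
   Context: The asymmetric-information two-player game: Player 1 chooses $x_1\in\mathrm{X}_1$ to minimize $J_1(x_1,x_2)$ over $x_1\in\mathrm{X}_1$, while Player 2 simultaneously reacts with $x_2\in\mathrm{BR}_2(x_1)$. Here $\mathrm{BR}_2(x_1)=\arg\min_{x_2\in\mathrm{X}_2}J_2(x_1,x_2)$ for some function $J_2:\mathrm{X}_1\times\mathrm{X}_2\to\mathbb{R}$ which need not be known; Player 2 enters only through $\mathrm{BR}_2$, and no assumptions are made on $J_2$ beyond those stated on $\mathrm{BR}_2$. A pair $(x_1^\star,x_2^\star)\in\mathrm{X}_1\times\mathrm{X}_2$ is a Nash equilibrium of this game if $x_1^\star\in\arg\min_{x_1\in\mathrm{X}_1}J_1(x_1,x_2^\star)$ and $x_2^\star\in\mathrm{BR}_2(x_1^\star)$. $\|\cdot\|$ is the Euclidean norm and $\nabla_{x_1}J_1(x_1,x_2)$ denotes the gradient of $J_1(\cdot,x_2)$ at $x_1$. *)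

(* Defs.v *)
From HB Require Import structures.
From mathcomp Require Import all_boot all_order all_algebra.
From mathcomp Require Import all_classical all_reals all_analysis.

Set Implicit Arguments.
Unset Strict Implicit.
Unset Printing Implicit Defensive.

Import Order.TTheory GRing.Theory Num.Theory.
Import numFieldNormedType.Exports.

Local Open Scope classical_set_scope.
Local Open Scope ring_scope.

(* The library norm on 'rV[R]_n is the sup norm, so the
   Euclidean structure is set up here.  The two norms induce the same topology,
   hence the library's [compact] and [continuous] need no change. *)
Definition dotrv (R : realType) (n : nat) (u v : 'rV[R]_n) : R :=
  \sum_(i < n) u ord0 i * v ord0 i.

Definition enorm (R : realType) (n : nat) (u : 'rV[R]_n) : R :=
  Num.sqrt (dotrv u u).

Definition argmin (R : realType) (T : Type) (A : set T) (f : T -> R) : set T :=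
  [set x | A x /\ forall y, A y -> f x <= f y].

(* [g] is a (Frechet) gradient at [x] of [f] restricted to [A]:
   f y = f x + <g, y - x> + o(|y - x|) as y -> x in A.
   Values of [f] off [A] are irrelevant, so this makes sense for functions
   defined only on [A], including at boundary points.  The ambient gradient,
   when it exists, is one such [g] (lemma [gradient_within_differentiable]);
   for [A] convex with nonempty interior [g] is unique, otherwise it is
   determined up to a vector orthogonal to the affine hull of [A]. *)
Definition gradient_within (R : realType) (n : nat) (A : set 'rV[R]_n)
    (f : 'rV[R]_n -> R) (x g : 'rV[R]_n) : Prop :=
  forall e : R, 0 < e -> \forall y \near within A (nbhs x),
    `|f y - f x - dotrv g (y - x)| <= e * enorm (y - x).

Definition strongly_convex (R : realType) (n : nat) (mu : R)
    (A : set 'rV[R]_n) (f : 'rV[R]_n -> R) : Prop :=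
  forall (x y : 'rV[R]_n) (t : R), A x -> A y -> 0 <= t -> t <= 1 ->
    f (t *: x + (1 - t) *: y) <=
    t * f x + (1 - t) * f y - mu / 2 * t * (1 - t) * enorm (x - y) ^+ 2.

Definition enorm_lipschitz (R : realType) (m n : nat) (L : R)
    (A : set 'rV[R]_m) (f : 'rV[R]_m -> 'rV[R]_n) : Prop :=
  forall x y, A x -> A y -> enorm (f x - f y) <= L * enorm (x - y).

Definition best_response (R : realType) (n1 n2 : nat) (X2 : set 'rV[R]_n2)
    (J2 : 'rV[R]_n1 -> 'rV[R]_n2 -> R) (x1 : 'rV[R]_n1) : set 'rV[R]_n2 :=
  argmin X2 (J2 x1).

Definition nash_equilibrium (R : realType) (n1 n2 : nat)
    (X1 : set 'rV[R]_n1) (X2 : set 'rV[R]_n2)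
    (J1 : 'rV[R]_n1 -> 'rV[R]_n2 -> R) (BR2 : 'rV[R]_n1 -> set 'rV[R]_n2)
    (p : 'rV[R]_n1 * 'rV[R]_n2) : Prop :=
  [/\ X1 p.1, X2 p.2, argmin X1 (fun x1 => J1 x1 p.2) p.1 & BR2 p.1 p.2].

Lemma gradient_within_differentiable (R : realType) (n : nat)
    (A : set 'rV[R]_n) (f : 'rV[R]_n -> R) (x : 'rV[R]_n) :
  differentiable f x ->
  gradient_within A f x (\row_i 'D_(delta_mx ord0 i) f x).
Proof.
move=> df e e0.
have dotE (h : 'rV[R]_n) : 'd f x h = dotrv (\row_i 'D_(delta_mx ord0 i) f x) h.
  rewrite {1}(row_sum_delta h) linear_sum; apply: eq_bigr => i _.
  by rewrite linearZ /= mxE deriveE // mulrC.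
have le_enorm (h : 'rV[R]_n) : `|h| <= enorm h.
  rewrite [leLHS]mx_normrE; apply/bigmax_leP; split => [|[i j] _] /=.
    exact: sqrtr_ge0.
  rewrite (ord1 i) -sqrtr_sqr ler_wsqrtr // /dotrv (bigD1 j) //= -expr2 lerDl.
  by apply: sumr_ge0 => k _; rewrite -expr2 sqr_ge0.
have [_ /eqaddoP /(_ e e0)] := (diff_locallyP x f).1 df.
move=> near_df; apply: cvg_within.
suff: \forall y \near x,
    `|f y - f x - dotrv (\row_i 'D_(delta_mx ord0 i) f x) (y - x)| <=
    e * enorm (y - x) by [].
rewrite (near_shift 0 x) subr0; move: near_df.
apply: filterS => h; rewrite /= !fctE /= addrK -dotE opprD addrA.
by move=> /le_trans; apply; rewrite ler_wpM2l // ltW.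
Qed.

(* Main.v *)
(* Let T x be the minimizer of J1(., BR2 x) over X1.  For a = T x and b = T y,
   the first-order conditions at a and b and strong monotonicity of the gradient
   of J1(., BR2 x) give
     mu |a - b| <= |grad J1(b, BR2 x) - grad J1(b, BR2 y)| <= L12 L2 |x - y|,
   so T is a contraction of X1 and has exactly one fixed point x; the only
   equilibrium is (x, BR2 x).  On a compact set the fixed point of a contraction
   is found as a minimizer of x |-> |x - T x|. *)
Require Import Defs.
From HB Require Import structures.
From mathcomp Require Import all_boot all_order all_algebra.
From mathcomp Require Import all_classical all_reals all_analysis.
From mathcomp Require Import ring lra.
Import Order.TTheory GRing.Theory Num.Theory.
Import numFieldNormedType.Exports.
Local Open Scope classical_set_scope.
Local Open Scope ring_scope.

Set Implicit Arguments.
Unset Strict Implicit.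

(** * Euclidean inner product and norm *)

Lemma dotrvC (R : realType) (n : nat) (u v : 'rV[R]_n) : dotrv u v = dotrv v u.
Proof. by apply: eq_bigr => i _; rewrite mulrC. Qed.

Lemma dotrvDl (R : realType) (n : nat) (u v w : 'rV[R]_n) :
  dotrv (u + v) w = dotrv u w + dotrv v w.
Proof. by rewrite -big_split; apply: eq_bigr => i _; rewrite mxE mulrDl. Qed.

Lemma dotrvZl (R : realType) (n : nat) (a : R) (u v : 'rV[R]_n) :
  dotrv (a *: u) v = a * dotrv u v.
Proof. by rewrite mulr_sumr; apply: eq_bigr => i _; rewrite mxE mulrA. Qed.

Lemma dotrvNl (R : realType) (n : nat) (u v : 'rV[R]_n) :
  dotrv (- u) v = - dotrv u v.
Proof. by rewrite -scaleN1r dotrvZl mulN1r. Qed.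

Lemma dotrvDr (R : realType) (n : nat) (u v w : 'rV[R]_n) :
  dotrv u (v + w) = dotrv u v + dotrv u w.
Proof. by rewrite dotrvC dotrvDl !(dotrvC u). Qed.

Lemma dotrvZr (R : realType) (n : nat) (a : R) (u v : 'rV[R]_n) :
  dotrv u (a *: v) = a * dotrv u v.
Proof. by rewrite dotrvC dotrvZl dotrvC. Qed.

Lemma dotrvNr (R : realType) (n : nat) (u v : 'rV[R]_n) :
  dotrv u (- v) = - dotrv u v.
Proof. by rewrite dotrvC dotrvNl dotrvC. Qed.

Lemma dotrv_ge0 (R : realType) (n : nat) (u : 'rV[R]_n) : 0 <= dotrv u u.
Proof. by apply: sumr_ge0 => i _; rewrite -expr2 sqr_ge0. Qed.

Lemma enorm_ge0 (R : realType) (n : nat) (u : 'rV[R]_n) : 0 <= enorm u.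
Proof. exact: sqrtr_ge0. Qed.

Lemma sqr_enorm (R : realType) (n : nat) (u : 'rV[R]_n) :
  enorm u ^+ 2 = dotrv u u.
Proof. exact/sqr_sqrtr/dotrv_ge0. Qed.

Lemma enorm_eq0 (R : realType) (n : nat) (u : 'rV[R]_n) : enorm u = 0 -> u = 0.
Proof.
move=> u0; have /eqP : dotrv u u = 0 by rewrite -sqr_enorm u0 expr0n.
rewrite psumr_eq0 => [/allP uu0|i _]; last by rewrite -expr2 sqr_ge0.
apply/rowP => i; have := uu0 i (mem_index_enum i).
by rewrite mulf_eq0 orbb mxE => /eqP.
Qed.

Lemma enormZ (R : realType) (n : nat) (a : R) (u : 'rV[R]_n) :
  enorm (a *: u) = `|a| * enorm u.
Proof.
by rewrite /enorm dotrvZl dotrvZr mulrA -expr2 sqrtrM ?sqr_ge0// sqrtr_sqr.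
Qed.

Lemma enormN (R : realType) (n : nat) (u : 'rV[R]_n) : enorm (- u) = enorm u.
Proof. by rewrite /enorm dotrvNl dotrvNr opprK. Qed.

Lemma enormB (R : realType) (n : nat) (u v : 'rV[R]_n) :
  enorm (u - v) = enorm (v - u).
Proof. by rewrite -enormN opprB. Qed.

(** Cauchy-Schwarz: for [a = enorm u] and [b = enorm v], the squared norm of [b *: u - a *: v] is
    [2 * a * b * (a * b - dotrv u v)], and it is nonnegative. Zero vectors are split off so that
    [a * b] can be cancelled. *)
Lemma dotrv_le_enorm (R : realType) (n : nat) (u v : 'rV[R]_n) :
  dotrv u v <= enorm u * enorm v.
Proof.
have := enorm_ge0 u; rewrite le_eqVlt => /predU1P[/esym/enorm_eq0 ->|u0].
  by rewrite -[X in dotrv X _](scale0r v) dotrvZl mul0r mulr_ge0 ?enorm_ge0.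
have := enorm_ge0 v; rewrite le_eqVlt => /predU1P[/esym/enorm_eq0 ->|v0].
  by rewrite -[X in dotrv _ X](scale0r u) dotrvZr mul0r mulr_ge0 ?enorm_ge0.
have := dotrv_ge0 (enorm v *: u - enorm u *: v).
rewrite dotrvDl !dotrvDr !dotrvNl !dotrvNr !dotrvZl !dotrvZr -!sqr_enorm.
rewrite (dotrvC v u); move: u0 v0; set a := enorm u; set b := enorm v => a0 b0.
have ab0 : 0 < a * b by rewrite mulr_gt0.
move=> h; rewrite -(ler_pM2l ab0); lra.
Qed.

Lemma enorm_triangle (R : realType) (n : nat) (u v : 'rV[R]_n) :
  enorm (u + v) <= enorm u + enorm v.
Proof.
rewrite -ler_sqr ?nnegrE ?addr_ge0 ?enorm_ge0// sqr_enorm sqrrD !sqr_enorm.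
rewrite dotrvDl !dotrvDr (dotrvC v u); have := dotrv_le_enorm u v; lra.
Qed.

(** Each of the [n] squares is at most the square of the sup norm. This carries Euclidean estimates
    over to the topology of the library. *)
Lemma enorm_le_norm (R : realType) (n : nat) (u : 'rV[R]_n) :
  enorm u <= Num.sqrt n%:R * `|u|.
Proof.
rewrite -[`|u|]ger0_norm// -sqrtr_sqr -sqrtrM// ler_wsqrtr//.
rewrite mulr_natl -[n in _ *+ n]card_ord -sumr_const ler_sum// => i _.
rewrite -expr2 -[leLHS]real_normK ?num_real// ler_pXn2r ?nnegrE//.
rewrite [leRHS]mx_normrE.
by apply: (le_bigmax _ (fun ij => `|u ij.1 ij.2|) (ord0, i)).
Qed.

(** * First-order conditions on a convex set *)

Lemma convex_set_comb (R : realType) (n : nat) (A : set 'rV[R]_n)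
    (x y : 'rV[R]_n) (t : R) : convex_set A -> A x -> A y ->
  0 <= t -> t <= 1 -> A (t *: x + (1 - t) *: y).
Proof.
move=> cA Ax Ay t0 t1.
by have := cA x y (Itv01 t0 t1) (mem_set Ax) (mem_set Ay); rewrite inE.
Qed.

(** Convexity keeps the segment from [x] to [y] inside [A], where the first-order expansion applies.
    The limit is one-sided because [x] may lie on the boundary. *)
Lemma gradient_within_dir_cvg (R : realType) (n : nat) (A : set 'rV[R]_n)
    (f : 'rV[R]_n -> R) (x y g : 'rV[R]_n) :
  convex_set A -> A x -> A y -> gradient_within A f x g ->
  (f (t *: y + (1 - t) *: x) - f x) / t @[t --> 0^'+] --> dotrv g (y - x).
Proof.
move=> cA Ax Ay fg; apply/cvgrPdist_le => e e0.
(* The expansion is used at level [e / (N + 1)]: its error [e / (N + 1) * t * N] is at most [e * t],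
   and the added 1 keeps the denominator positive when [y = x]. *)
set N := enorm (y - x); have N1 : 0 < N + 1 by rewrite ltr_wpDl ?enorm_ge0.
have toxE t : t *: y + (1 - t) *: x = x + t *: (y - x).
  by rewrite scalerBl scale1r scalerBr addrCA.
have tox : t *: y + (1 - t) *: x @[t --> (0 : R)^'+] --> x.
  apply: cvg_at_right_filter; under eq_fun do rewrite toxE.
  suff : x + t *: (y - x) @[t --> (0 : R)] --> x + 0 *: (y - x).
    by rewrite scale0r addr0.
  by apply: cvgD; [exact: cvg_cst|apply: cvgZr_tmp; exact: cvg_id].
have {fg} := tox _ (fg _ (divr_gt0 e0 N1)); rewrite /= => near_fg.
near=> t.
have t0 : 0 < t by near: t; exact: nbhs_right_gt.
have t1 : t <= 1 by near: t; apply: nbhs_right_le.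
have Aty := convex_set_comb cA Ay Ax (ltW t0) t1.
have : `|f (t *: y + (1 - t) *: x) - f x
         - dotrv g (t *: y + (1 - t) *: x - x)|
       <= e / (N + 1) * enorm (t *: y + (1 - t) *: x - x).
  by move: Aty; near: t.
rewrite {2 3}toxE (addrAC x) subrr add0r dotrvZr enormZ (gtr0_norm t0) -/N.
move=> fle.
rewrite distrC -(ler_pM2l t0) -{1}(gtr0_norm t0) -normrM mulrBr mulrCA.
rewrite divff ?gt_eqF// mulr1; apply: (le_trans fle).
rewrite mulrCA ler_pM2l// mulrAC ler_pdivrMr// ler_pM2l//.
by rewrite lerDl.
Unshelve. all: by end_near.
Qed.

(** The difference quotients from a minimizer towards [y] are nonnegative, hence so is their
    limit. *)
Lemma argmin_gradient_within (R : realType) (n : nat) (A : set 'rV[R]_n)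
    (f : 'rV[R]_n -> R) (x y g : 'rV[R]_n) :
  convex_set A -> gradient_within A f x g -> argmin A f x -> A y ->
  0 <= dotrv g (y - x).
Proof.
move=> cA fg [Ax fx] Ay.
apply: (cvgr_to_ge (gradient_within_dir_cvg cA Ax Ay fg)).
near=> t.
have t0 : 0 < t by near: t; exact: nbhs_right_gt.
have t1 : t <= 1 by near: t; apply: nbhs_right_le.
rewrite divr_ge0 ?(ltW t0)// subr_ge0 fx//.
by apply: convex_set_comb => //; exact: ltW.
Unshelve. all: by end_near.
Qed.

(** Strong convexity with weight [t] on [y], divided by [t], bounds the difference quotient by
    [f y - f x - mu / 2 * (1 - t) * N ^+ 2]; then [t] tends to 0 from the right. *)
Lemma strongly_convex_gradient_le (R : realType) (n : nat) (mu : R)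
    (A : set 'rV[R]_n) (f : 'rV[R]_n -> R) (x y g : 'rV[R]_n) :
  convex_set A -> strongly_convex mu A f -> gradient_within A f x g ->
  A x -> A y ->
  dotrv g (y - x) <= f y - f x - mu / 2 * enorm (y - x) ^+ 2.
Proof.
move=> cA scf fg Ax Ay; set N := enorm (y - x).
have bound_cvg : f y - f x - mu / 2 * (1 - t) * N ^+ 2 @[t --> (0 : R)^'+] -->
    f y - f x - mu / 2 * N ^+ 2.
  apply: cvg_at_right_filter; apply: cvgB; first exact: cvg_cst.
  apply: cvgMr_tmp.
  suff : mu / 2 * (1 - t) @[t --> (0 : R)] --> mu / 2 * (1 - 0).
    by rewrite subr0 mulr1.
  by apply: cvgMl_tmp; apply: cvgB; [exact: cvg_cst|exact: cvg_id].
apply: (ler_cvg_to (gradient_within_dir_cvg cA Ax Ay fg) bound_cvg).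
near=> t.
have t0 : 0 < t by near: t; exact: nbhs_right_gt.
have t1 : t <= 1 by near: t; apply: nbhs_right_le.
rewrite ler_pdivrMr//; have := scf _ _ _ Ay Ax (ltW t0) t1; rewrite -/N; lra.
Unshelve. all: by end_near.
Qed.

(** In the sum of the gradient inequalities at [x] and at [y] the values of [f] cancel and the two
    [mu / 2] terms add up to [mu]. *)
Lemma strongly_convex_gradient_monotone (R : realType) (n : nat) (mu : R)
    (A : set 'rV[R]_n) (f : 'rV[R]_n -> R) (x y gx gy : 'rV[R]_n) :
  convex_set A -> strongly_convex mu A f -> gradient_within A f x gx ->
  gradient_within A f y gy -> A x -> A y ->
  mu * enorm (x - y) ^+ 2 <= dotrv (gx - gy) (x - y).
Proof.
move=> cA scf fgx fgy Ax Ay.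
have := strongly_convex_gradient_le cA scf fgx Ax Ay.
have := strongly_convex_gradient_le cA scf fgy Ay Ax.
rewrite -(opprB x y) enormN dotrvNr dotrvDl dotrvNl; lra.
Qed.

(** Optimality gives [dotrv fx (x - y) <= 0 <= dotrv hy (x - y)]. Monotonicity then yields [mu *
    enorm (x - y) ^+ 2 <= dotrv (fy - hy) (y - x)]; Cauchy-Schwarz and division by [enorm (x - y)]
    finish, the case [x = y] being trivial. *)
Lemma argmin_enorm_le (R : realType) (n : nat) (mu : R)
    (A : set 'rV[R]_n) (f h : 'rV[R]_n -> R) (x y fx fy hy : 'rV[R]_n) :
  convex_set A -> strongly_convex mu A f -> gradient_within A f x fx ->
  gradient_within A f y fy -> gradient_within A h y hy ->
  argmin A f x -> argmin A h y ->
  mu * enorm (x - y) <= enorm (fy - hy).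
Proof.
move=> cA scf ffx ffy fhy mfx mhy.
have := enorm_ge0 (x - y).
rewrite le_eqVlt => /predU1P[<-|xy0]; first by rewrite mulr0 enorm_ge0.
rewrite -(ler_pM2r xy0).
have mono :=
  strongly_convex_gradient_monotone cA scf ffx ffy mfx.1 mhy.1.
have := argmin_gradient_within cA ffx mfx mhy.1.
have := argmin_gradient_within cA fhy mhy mfx.1.
have := dotrv_le_enorm (fy - hy) (y - x).
rewrite (enormB y x) -(opprB x y) !dotrvNr dotrvDl dotrvNl.
move: mono; rewrite dotrvDl dotrvNl; lra.
Qed.

(** * Fixed points of contractions on compact sets *)

Lemma enorm_lipschitz_continuous (R : realType) (n : nat) (K : R)
    (A : set 'rV[R]_n) (f : 'rV[R]_n -> R) : 0 <= K ->
  (forall x y, A x -> A y -> f x - f y <= K * enorm (x - y)) ->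
  {within A, continuous f}.
Proof.
move=> K0 fK; apply/subspace_continuousP => x Ax.
apply/cvgrPdist_le => e e0.
(* The factor [Num.sqrt n%:R] converts from the sup norm; the added 1 makes [C] positive even if [K]
   or [n] is 0. *)
set C := K * Num.sqrt n%:R + 1.
have C0 : 0 < C by rewrite ltr_wpDl// mulr_ge0.
suff : \forall y \near x, A y -> `|f x - f y| <= e by [].
near=> y => Ay.
have xy : `|x - y| <= e / C.
  near: y; have /cvgrPdist_le := @cvg_id _ (nbhs x); apply; exact: divr_gt0.
have fe u v : `|u - v| <= e / C -> A u -> A v -> f u - f v <= e.
  move=> uv Au Av; apply: (le_trans (fK _ _ Au Av)).
  apply: (le_trans (ler_wpM2l K0 (enorm_le_norm _))).
  rewrite mulrA -[leRHS](divfK (lt0r_neq0 C0)) mulrC ler_pM//.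
    by rewrite mulr_ge0.
  by rewrite lerDl.
by rewrite ler_norml lerNl opprB !fe// distrC.
Unshelve. all: by end_near.
Qed.

(** At a minimizer [x] of the displacement [d = enorm (x - T x)], comparison with the point [T x]
    gives [d <= q * d], so [d = 0] as [q < 1]. *)
Lemma enorm_contraction_fixpoint (R : realType) (n : nat) (q : R)
    (A : set 'rV[R]_n) (T : 'rV[R]_n -> 'rV[R]_n) :
  A !=set0 -> compact A -> 0 <= q -> q < 1 ->
  (forall x, A x -> A (T x)) -> enorm_lipschitz q A T ->
  exists2 x, A x & T x = x.
Proof.
move=> A0 cA q0 q1 AT Tq.
have phi_cont : {within A, continuous (fun x => enorm (x - T x))}.
  (* In the constant, 1 accounts for [x - y] and [q] for [T y - T x]. *)
  apply: (@enorm_lipschitz_continuous _ _ (1 + q)); first by rewrite addr_ge0.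
  move=> x y Ax Ay; have := Tq _ _ Ax Ay.
  have -> : x - T x = (x - y) + ((y - T y) + (T y - T x)).
    by rewrite [y - T y + _]addrA subrK [RHS]addrA subrK.
  have := enorm_triangle (x - y) ((y - T y) + (T y - T x)).
  have := enorm_triangle (y - T y) (T y - T x).
  rewrite (enormB (T y) (T x)); lra.
have [x /set_mem Ax xmin] := compact_EVT_min A0 cA phi_cont.
exists x => //; apply/esym/subr0_eq/enorm_eq0/eqP.
have := xmin _ (mem_set (AT _ Ax)); have := Tq _ _ Ax (AT _ Ax).
have := enorm_ge0 (x - T x); set d := enorm _ => d0 h1 h2.
by rewrite eq_le d0 andbT; nra.
Qed.

(** * Existence and uniqueness of the equilibrium *)

Unset Implicit Arguments.
Set Strict Implicit.

Theorem theorem2 (R : realType) (n1 n2 : nat)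
    (X1 : set 'rV[R]_n1) (X2 : set 'rV[R]_n2)
    (J1 J2 : 'rV[R]_n1 -> 'rV[R]_n2 -> R)
    (gradJ1 : 'rV[R]_n1 -> 'rV[R]_n2 -> 'rV[R]_n1)
    (br2 : 'rV[R]_n1 -> 'rV[R]_n2)
    (mu L12 L2 : R)
    (X1_nonempty : X1 !=set0) (X1_convex : convex_set X1)
    (X1_compact : compact X1)
    (X2_nonempty : X2 !=set0) (X2_convex : convex_set X2)
    (X2_compact : compact X2)
    (J1_continuous : {within X1 `*` X2,
      continuous (fun p : 'rV[R]_n1 * 'rV[R]_n2 => J1 p.1 p.2)})
    (mu_gt0 : 0 < mu)
    (J1_differentiable : forall x1 x2, X1 x1 -> X2 x2 ->
      gradient_within X1 (fun z => J1 z x2) x1 (gradJ1 x1 x2))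
    (J1_strongly_convex : forall x2, X2 x2 ->
      strongly_convex mu X1 (fun z => J1 z x2))
    (L12_ge0 : 0 <= L12)
    (gradJ1_lipschitz : forall x1, X1 x1 -> enorm_lipschitz L12 X2 (gradJ1 x1))
    (BR2_single_valued : forall x1, X1 x1 ->
      best_response X2 J2 x1 = [set br2 x1])
    (L2_ge0 : 0 <= L2)
    (BR2_lipschitz : enorm_lipschitz L2 X1 br2)
    (mu_gt : L12 * L2 < mu) :
  exists! p : 'rV[R]_n1 * 'rV[R]_n2,
    nash_equilibrium X1 X2 J1 (best_response X2 J2) p.
Proof.
have X2br x : X1 x -> X2 (br2 x).
  move=> X1x; suff : best_response X2 J2 x (br2 x) by case.
  by rewrite BR2_single_valued.
(* Joint continuity is pulled back along [z |-> (z, v)], which maps [X1] into the product. *)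
have J1_slice v : X2 v -> {within X1, continuous (fun z => J1 z v)}.
  move=> X2v; apply/subspace_continuousP => x X1x W xW.
  have near_xv : nbhs (x, v) (fun p => (X1 `*` X2) p -> W (J1 p.1 p.2)).
    exact: ((subspace_continuousP _ _).1 J1_continuous (x, v) (conj X1x X2v)
      W xW).
  have cpair : (z, v) @[z --> x] --> nbhs (x, v).
    by apply: (@cvg_pair _ _ _ (nbhs x) (nbhs x) (nbhs v) _ _ _ id (fun=> v));
      [exact: cvg_id|exact: cvg_cst].
  suff : \forall z \near x, X1 z -> W (J1 z v) by [].
  by apply: (@filterS _ (nbhs x) _ _ _ _ (cpair _ near_xv))
    => z /= zW X1z; exact: zW.
(* [get] selects a point of a set and is meaningful only when the set is nonempty; for [x] in [X1]
   the extreme value theorem ensures this. *)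
pose T x := get (argmin X1 (fun z => J1 z (br2 x))).
have argminT x : X1 x -> argmin X1 (fun z => J1 z (br2 x)) (T x).
  move=> X1x; apply: getPex.
  have [c /set_mem X1c cmin] :=
    compact_EVT_min X1_nonempty X1_compact (J1_slice _ (X2br _ X1x)).
  by exists c; split=> // y /mem_set /cmin.
(* Stated for arbitrary minimizers [a] and [b], so that it serves both the contraction property of
   [T] and uniqueness. The two gradients compared are taken at [b], against [br2 x] and [br2 y]. *)
have contract x y a b : X1 x -> X1 y ->
    argmin X1 (fun z => J1 z (br2 x)) a ->
    argmin X1 (fun z => J1 z (br2 y)) b ->
    mu * enorm (a - b) <= L12 * L2 * enorm (x - y).
  move=> X1x X1y ma mb; have X1a := ma.1; have X1b := mb.1.
  have X2x := X2br _ X1x; have X2y := X2br _ X1y.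
  apply: le_trans (argmin_enorm_le X1_convex
    (J1_strongly_convex _ X2x) (J1_differentiable _ _ X1a X2x)
    (J1_differentiable _ _ X1b X2x) (J1_differentiable _ _ X1b X2y) ma mb) _.
  apply: le_trans (gradJ1_lipschitz _ X1b _ _ X2x X2y) _.
  by rewrite -mulrA ler_wpM2l// BR2_lipschitz.
have q0 : 0 <= L12 * L2 / mu by rewrite divr_ge0 ?mulr_ge0// ltW.
have q1 : L12 * L2 / mu < 1 by rewrite ltr_pdivrMr// mul1r.
have X1T x : X1 x -> X1 (T x) by move=> /argminT[].
have Tq : enorm_lipschitz (L12 * L2 / mu) X1 T.
  move=> x y X1x X1y; rewrite mulrAC ler_pdivlMr// mulrC.
  by apply: contract => //; exact: argminT.
have [x X1x Tx] :=
  enorm_contraction_fixpoint X1_nonempty X1_compact q0 q1 X1T Tq.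
exists (x, br2 x); split => [|[y v] [/= X1y X2v my]].
  split=> //=; [exact: X2br|by rewrite -[X in argmin _ _ X]Tx; exact: argminT|].
  by rewrite BR2_single_valued.
(* Any equilibrium [(y, v)] has [v = br2 y], so [y] minimizes against [br2 y] just as [x] does
   against [br2 x]. Then [contract] gives [(mu - L12 * L2) * enorm (x - y) <= 0], which forces
   [x = y]. *)
rewrite BR2_single_valued// => vE; move: my; rewrite /= vE => my.
have mx := argminT _ X1x; rewrite Tx in mx.
have xy := contract _ _ _ _ X1x X1y mx my.
have x_eq : x = y.
  apply/subr0_eq/enorm_eq0/eqP; rewrite eq_le enorm_ge0 andbT.
  rewrite -(pmulr_rle0 (enorm (x - y)) (_ : 0 < mu - L12 * L2)) ?subr_gt0//.
  by rewrite mulrBl subr_le0.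
by rewrite x_eq.
Qed.
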